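(* Let $X$ with $|X| = k$ be a non-empty finite subset of $\mathbb{R}^n$, where $\mathbb{R}^n$ has the metric induced by the $1$-norm $\|\cdot\|_1$. Then \[ M(X) \le \frac{k}{4}\cdot D(X). \]
   Context: For a compact (in particular finite) metric space $(X,d)$, $D(X)$ denotes its metric diameter, and $M(X) = \sup_\mu \int_X\int_X d(x,y)\,d\mu(x)\,d\mu(y)$, where $\mu$ ranges over all finite signed Borel measures on $X$ of total mass $1$. *)

(* Defs.v *)
From HB Require Import structures.
From mathcomp Require Import all_boot all_order all_algebra.
From mathcomp Require Import all_classical all_reals all_analysis.

Set Implicit Arguments.
Unset Strict Implicit.
Unset Printing Implicit Defensive.

Import Order.TTheory GRing.Theory Num.Theory.
Import numFieldNormedType.Exports.

Local Open Scope classical_set_scope.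
Local Open Scope ring_scope.

(* [measurableType] requires [Pointed], so the metric spaces on which Borel
   measures are considered are non-empty. *)
#[short(type="pointedMetricType")]
HB.structure Definition PointedMetric (K : numDomainType) :=
  { T of Metric K T & Pointed T }.

Definition l1norm (R : realType) (n : nat) (v : 'rV[R]_n) : R :=
  \sum_(i < n) `|v ord0 i|.

(* An alias, since ['rV[R]_n] carries the metric of the sup norm. *)
Definition l1space (R : realType) (n : nat) : Type := 'rV[R]_n.

Section l1space_metric.
Variables (R : realType) (n : nat).
Implicit Types x y z : l1space R n.

Definition l1dist x y : R := l1norm ((x : 'rV[R]_n) - (y : 'rV[R]_n)).

Lemma l1distxx x : l1dist x x = 0.
Proof. by rewrite /l1dist subrr /l1norm big1// => i _; rewrite mxE normr0. Qed.

Lemma l1dist_positivity x y : l1dist x y = 0 -> x = y.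
Proof.
move=> /eqP; rewrite psumr_eq0// => /allP xy; apply/rowP => i.
have := xy i (mem_index_enum i).
by rewrite /= normr_eq0 !mxE subr_eq0 => /eqP.
Qed.

Lemma l1dist_sym x y : l1dist x y = l1dist y x.
Proof. by apply: eq_bigr => i _; rewrite !mxE distrC. Qed.

Lemma l1dist_triangle y x z : l1dist x z <= l1dist x y + l1dist y z.
Proof.
rewrite /l1dist /l1norm -big_split/=; apply: ler_sum => i _.
by rewrite !mxE ler_distD.
Qed.

HB.instance Definition _ := Choice.on (l1space R n).
HB.instance Definition _ := @isMetric.Build R (l1space R n)
  l1dist l1distxx l1dist_positivity l1dist_sym l1dist_triangle.
End l1space_metric.

Definition subspace_of (T : Type) (X : set T) (X0 : X !=set0) : Type :=
  set_type X.

Section subspace_metric.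
Variables (R : realType) (T : metricType R) (X : set T) (X0 : X !=set0).

Let S : Type := subspace_of X0.

Definition subdist (x y : S) : R := mdist (set_val x : T) (set_val y : T).

Lemma subdist_ge0 x y : 0 <= subdist x y.
Proof. exact: mdist_ge0. Qed.

Lemma subdist_positivity x y : subdist x y = 0 -> x = y.
Proof. by move=> /mdist_positivity; exact: val_inj. Qed.

(* The topology is the one the library puts on [set_type X]; the instance
   below shows that it is the topology of the restricted distance. *)
HB.instance Definition _ := PseudoMetric.copy S (set_type X).

Lemma ballEsubdist (x : S) e : ball x e = [set y | subdist x y < e].
Proof.
apply/seteqP; split=> y /=;
by rewrite /ball/= /initial_ball /= ballEmdist.
Qed.

HB.instance Definition _ := @PseudoMetric_isMetric.Build R S
  subdist subdist_ge0 subdist_positivity ballEsubdist.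

HB.instance Definition _ := @isPointed.Build S
  (exist _ (projT1 (cid X0)) (mem_set (projT2 (cid X0)))).
End subspace_metric.

Local Open Scope ereal_scope.

(* The Jordan decomposition of [nu] does not depend on the Hahn decomposition
   it is computed from, so the choice made by [cid] is immaterial. *)
Definition charge_integral (d : measure_display) (T : measurableType d)
    (R : realType) (nu : {charge set T -> \bar R}) (f : T -> \bar R) : \bar R :=
  let nuPN := projT2 (cid (projT2 (cid (Hahn_decomposition nu)))) in
  \int[jordan_pos nuPN]_x f x - \int[jordan_neg nuPN]_x f x.

Definition borel (R : realType) (T : pointedMetricType R) :=
  g_sigma_algebraType (@open T).

Definition energy (R : realType) (T : pointedMetricType R)
    (mu : {charge set (borel T) -> \bar R}) : \bar R :=
  charge_integral mu (fun y : T =>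
    charge_integral mu (fun x : T => (mdist x y)%:E)).

Definition metric_M (R : realType) (T : pointedMetricType R) : \bar R :=
  ereal_sup [set energy mu | mu in
    [set mu : {charge set (borel T) -> \bar R} | mu [set: T] = 1]].

Definition diameter (R : realType) (T : metricType R) : \bar R :=
  ereal_sup [set (mdist p.1 p.2)%:E | p in [set: T * T]].

(* Main.v *)
(** A measure of mass 1 on a finite space is a weight [w] on its points, and the
    energy splits over coordinates. On the line, sliding the leftmost mass onto
    its neighbour shows that the energy is at most half the width of the point
    set. Conversely, each inner point is at total distance at least the width
    from the two end points, so the sum of the distances over ordered pairs is
    at least [2 (k - 1)] times the width. Hence [4 (k - 1)] times the energy is
    bounded, coordinatewise and thus in the 1-norm, by the sum of all distances,
    which is at most [k (k - 1) D]; the case [k = 1] is trivial. *)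
Require Import Defs.
From HB Require Import structures.
From mathcomp Require Import all_boot all_order all_algebra.
From mathcomp Require Import all_classical all_reals all_analysis.
From mathcomp Require Import ring lra.
Set Implicit Arguments.
Unset Strict Implicit.
Unset Printing Implicit Defensive.

Import Order.TTheory GRing.Theory Num.Theory.
Import numFieldNormedType.Exports.

Local Open Scope classical_set_scope.
Local Open Scope card_scope.
Local Open Scope ring_scope.

(** * Sums over ordered pairs, and the energy of masses on a line *)

Lemma sum_pairs_cons (R : comPzRingType) (T : Type) (D : T -> T -> R) p s :
  (forall a b, D a b = D b a) -> D p p = 0 ->
  \sum_(a <- p :: s) \sum_(b <- p :: s) D a b =
    2 * \sum_(b <- s) D p b + \sum_(a <- s) \sum_(b <- s) D a b.
Proof.
move=> Dsym Dpp; rewrite big_cons big_cons Dpp add0r.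
under [X in _ + X = _]eq_bigr do rewrite big_cons Dsym.
by rewrite big_split/= addrA mulr2n mulrDl mul1r.
Qed.

Lemma perm_sum_pairs (R : pzSemiRingType) (T : eqType) (D : T -> T -> R) s t :
  perm_eq s t ->
  \sum_(a <- s) \sum_(b <- s) D a b = \sum_(a <- t) \sum_(b <- t) D a b.
Proof.
by move=> st; rewrite (perm_big _ st); apply: eq_bigr => a _; exact: perm_big.
Qed.

Section line.
Variable R : realFieldType.
Implicit Types (p q : R * R) (s : seq (R * R)).

Let le_fst p q := p.1 <= q.1.

(* A pair [p] stands for the mass [p.2] at the point [p.1]. *)
Let energy_kernel p q : R := p.2 * q.2 * `|p.1 - q.1|.

(* Moving the leftmost mass [w] rightwards by [d] onto its neighbour lowers the
   energy by [2 w (S - w) d <= S^2 d / 2], where [S] is the total mass. *)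
Let sorted_energy_le p s : path le_fst p s ->
  2 * \sum_(a <- p :: s) \sum_(b <- p :: s) energy_kernel a b <=
  (\sum_(a <- p :: s) a.2) ^+ 2 * ((last p s).1 - p.1).
Proof.
have kC a b : energy_kernel a b = energy_kernel b a.
  by rewrite /energy_kernel distrC (mulrC a.2).
have k0 a : energy_kernel a a = 0.
  by rewrite /energy_kernel subrr normr0 mulr0.
elim: s p => [|q s IH] p /=.
  by rewrite !big_seq1 k0 subrr !mulr0.
move=> /andP[pq qs].
have qle r : r \in s -> q.1 <= r.1.
  move=> rs; have : path (relpre fst <=%O) q s by [].
  move/order_path_min => /(_ _)/allP; apply => //.
  by move=> a b c /=; exact: le_trans.
have {IH} := IH (q.1, p.2 + q.2).
have -> : (last (q.1, p.2 + q.2) s).1 = (last q s).1 by case: (s).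
have -> : path le_fst (q.1, p.2 + q.2) s by case: (s) qs.
move=> /(_ isT); rewrite !sum_pairs_cons// !big_cons /=.
(* [P] is the first moment of [s] about [q.1]. As [s] lies to the right of [q.1], a mass at or left
   of [q.1] interacts with [s] only through [P] and the total mass [W]. *)
set P := \sum_(r <- s) r.2 * (r.1 - q.1).
set W := \sum_(r <- s) r.2.
have kE a : a.1 <= q.1 ->
    \sum_(r <- s) energy_kernel a r = a.2 * ((q.1 - a.1) * W + P).
  move=> aq; rewrite /W /P big_distrr -big_split big_distrr /=.
  apply: eq_big_seq => r /qle qr; rewrite /energy_kernel distrC.
  by rewrite ger0_norm ?subr_ge0 ?(le_trans aq)//; ring.
rewrite !kE// /energy_kernel distrC ger0_norm ?subr_ge0//=.
set E := \sum_(_ <- s) _; set l := (last q s).1 => H.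
(* The slack in the goal exceeds the slack in [H] by exactly this term, since
   [S^2 - 4 p.2 (S - p.2)] is a square whatever the signs of the masses. *)
have : 0 <= (q.1 - p.1) * (p.2 - (q.2 + W)) ^+ 2.
  by rewrite mulr_ge0 ?subr_ge0 ?sqr_ge0.
by move: H; lra.
Qed.

(** For nonempty [s], only pairs meeting an end point are kept. The ends are one width apart, each
    of the [size s - 1] inner points adds at least one more width, and the factor 2 counts both
    orders. *)
Let sorted_width_le p s : path le_fst p s ->
  (size s)%:R * (2 * ((last p s).1 - p.1)) <=
    \sum_(a <- p :: s) \sum_(b <- p :: s) `|a.1 - b.1|.
Proof.
case/lastP: s => [|s r] _; first by rewrite mul0r !big_seq1 subrr normr0.
rewrite last_rcons size_rcons -natr1 mulrDl mul1r.
(* With the right end in second place, both ends can be split off by [sum_pairs_cons]. *)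
rewrite (@perm_sum_pairs _ _ _ _ [:: p, r & s]); last first.
  by rewrite perm_cons perm_rcons.
rewrite !sum_pairs_cons ?subrr ?normr0//; try by move=> *; rewrite distrC.
rewrite big_cons addrA -mulrDr -addrA -big_split/=.
apply: (@le_trans _ _ (2 * (`|p.1 - r.1| +
    \sum_(a <- s) (`|p.1 - a.1| + `|r.1 - a.1|)))); last first.
  by rewrite lerDl sumr_ge0// => a _; exact: sumr_ge0.
rewrite mulrCA -mulrDr ler_pM2l// addrC lerD//.
  by rewrite distrC ler_norm.
rewrite mulr_natl -iter_addr_0 -(count_predT s) -big_const_seq ler_sum// => a _.
rewrite (le_trans (ler_norm _))// (le_trans (ler_distD a.1 _ _))//.
by rewrite (distrC a.1) addrC.
Qed.

(** Eliminating the width between the two bounds above leaves pair sums of distances on both sides,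
    which can then be added over coordinates. *)
Lemma line_energy_le (T : Type) (s : seq T) (x w : T -> R) :
  4 * (size s).-1%:R * (\sum_(a <- s) \sum_(b <- s) w a * w b * `|x a - x b|)
  <= (\sum_(a <- s) w a) ^+ 2 * \sum_(a <- s) \sum_(b <- s) `|x a - x b|.
Proof.
pose f a := (x a, w a).
have pairs_map (D : R * R -> R * R -> R) :
    \sum_(a <- s) \sum_(b <- s) D (f a) (f b) =
    \sum_(a <- map f s) \sum_(b <- map f s) D a b.
  by rewrite big_map; apply: eq_bigr => a _; rewrite big_map.
rewrite -[\sum_(a <- s) w a](big_map f xpredT snd) -(size_map f).
rewrite (pairs_map energy_kernel) (pairs_map (fun a b => `|a.1 - b.1|)).
set t := sort le_fst (map f s).
have st : perm_eq (map f s) t by rewrite perm_sym perm_sort.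
rewrite !(perm_sum_pairs _ st) (perm_big _ st) (perm_size st).
have : sorted le_fst t by apply: sort_sorted => a b; exact: le_total.
case: {st} t => [|p t] /=; first by rewrite !big_nil !mulr0.
move=> pt; have E := sorted_energy_le pt; have W := sorted_width_le pt.
(* Since [p] has been split off, [size t] is the number of points minus one. *)
have := ler_wpM2l (ler0n R (size t)) E.
have := ler_wpM2l (sqr_ge0 (\sum_(a <- p :: t) a.2)) W.
by lra.
Qed.
End line.

(** * From the line to the 1-norm *)

Lemma sum_pairs_le (R : numDomainType) (T : Type) (D : T -> T -> R) (c : R) s :
  (forall a b, D a b = D b a) -> (forall a, D a a = 0) ->
  (forall a b, D a b <= c) ->
  \sum_(a <- s) \sum_(b <- s) D a b <= (size s)%:R * (size s).-1%:R * c.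
Proof.
move=> Dsym D0 Dc; elim: s => [|p s IH]; first by rewrite big_nil !mul0r.
rewrite sum_pairs_cons//=.
have -> : (size s).+1%:R * (size s)%:R * c =
    2 * (c *+ size s) + (size s)%:R * (size s).-1%:R * c.
  (* The predecessor is truncated at 0, so the empty tail is treated apart. *)
  case: (size s) => [|m] /=; first by rewrite !(mulr0, mul0r, addr0).
  by rewrite -mulr_natl -!natr1; ring.
rewrite lerD// ler_wpM2l// -iter_addr_0 -(count_predT s) -big_const_seq.
exact: ler_sum.
Qed.

Lemma l1_energy_le (R : realType) (n : nat) (T : Type) (s : seq T)
    (v : T -> l1space R n) (w : T -> R) :
  4 * (size s).-1%:R *
    (\sum_(a <- s) \sum_(b <- s) w a * w b * l1dist (v a) (v b)) <=
  (\sum_(a <- s) w a) ^+ 2 * \sum_(a <- s) \sum_(b <- s) l1dist (v a) (v b).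
Proof.
(* The coefficient [c] serves both the weighted sum and, with [c = 1], the plain one. *)
have sum_coord (c : T -> T -> R) :
    \sum_(a <- s) \sum_(b <- s) c a b * l1dist (v a) (v b) =
    \sum_(i < n) \sum_(a <- s) \sum_(b <- s)
      c a b * `|(v a : 'rV[R]_n) ord0 i - (v b : 'rV[R]_n) ord0 i|.
  rewrite [RHS]exchange_big; apply: eq_bigr => a _.
  rewrite [RHS]exchange_big; apply: eq_bigr => b _.
  by rewrite mulr_sumr; apply: eq_bigr => i _; rewrite !mxE.
have -> : \sum_(a <- s) \sum_(b <- s) l1dist (v a) (v b) =
    \sum_(a <- s) \sum_(b <- s) 1 * l1dist (v a) (v b).
  by apply: eq_bigr => a _; apply: eq_bigr => b _; rewrite mul1r.
rewrite !sum_coord !mulr_sumr; apply: ler_sum => i _.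
apply: le_trans (line_energy_le s (fun a => (v a : 'rV[R]_n) ord0 i) w) _.
rewrite ler_wpM2l ?sqr_ge0// ler_sum// => a _; rewrite ler_sum// => b _.
by rewrite mul1r.
Qed.

(** * Charges on a finite space as weights on its points *)

Lemma enum_card_eq (T : choiceType) (A : set T) (k : nat) : A #= `I_k ->
  exists s : seq (set_type A), [/\ uniq s, size s = k & forall x, x \in s].
Proof.
rewrite -(card_eql (card_setT A)) => Ak.
exists (finmap.enum_fset (fset_set [set: set_type A])); split.
  exact: finmap.fset_uniq.
  exact: card_fset_set.
by move=> x; rewrite in_fset_set ?inE//; apply/finite_setP; exists k.
Qed.

Local Open Scope ereal_scope.

(** Metric spaces are Hausdorff, so points are closed. *)
Lemma borel_measurable_set1 (R : realType) (T : pointedMetricType R)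
  (x : borel T) : measurable [set x].
Proof.
rewrite -[X in measurable X]setCK; apply: measurableC.
apply: sub_sigma_algebra; apply: closed_openC.
apply: (@accessible_closed_set1 T); apply: hausdorff_accessible.
exact: metric_hausdorff.
Qed.

Lemma jordan_posBneg (d : measure_display) (T : measurableType d)
    (R : realType) (nu : {charge set T -> \bar R}) (P N : set T)
    (nuPN : hahn_decomposition nu P N) (A : set T) : measurable A ->
  nu A = jordan_pos nuPN A - jordan_neg nuPN A.
Proof. by move=> mA; rewrite (jordan_decomp nuPN mA) /cadd/= cscaleN1. Qed.

Section finite_measurable_space.
Context (d : measure_display) (T : measurableType d) (R : realType).
Variable s : seq T.
Hypothesis measurable_set1 : forall x : T, measurable [set x].
Hypotheses (uniq_s : uniq s) (s_full : forall x, x \in s).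

(** Every set is a finite union of singletons; hence every function on [T] is measurable. *)
Let measurable_all (A : set T) : measurable A.
Proof.
rewrite -(image_id A) -bigcup_imset1; apply: fin_bigcup_measurable => //.
apply: (@sub_finite_set _ _ [set` s]) => [x _|]; first exact: s_full.
exact: finite_seq.
Qed.

Let bigsetU_set1 : \big[setU/set0]_(x <- s) [set x] = [set: T].
Proof. 
rewrite -bigcup_seq; apply/seteqP; split=> [//|x _].
by exists x; first exact: s_full. Qed.

Let trivIset_set1 : trivIset [set` s] (@set1 T).
Proof. by move=> x y _ _ [z [-> ->]]. Qed.

Lemma integral_finite_space (mu : {finite_measure set T -> \bar R})
    (f : T -> R) :
  \int[mu]_x (f x)%:E = (\sum_(x <- s) f x * fine (mu [set x]))%:E.
Proof.
rewrite -bigsetU_set1 integral_bigsetU_EFin//.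
rewrite -sumEFin; apply: eq_bigr => x _.
rewrite (eq_integral (cst (f x)%:E)); last by move=> y; rewrite inE => ->.
by rewrite integral_cst// EFinM fineK// fin_num_measure.
Qed.

Lemma charge_integral_finite_space (nu : {charge set T -> \bar R})
    (f : T -> R) :
  charge_integral nu (fun x => (f x)%:E) =
  (\sum_(x <- s) f x * fine (nu [set x]))%:E.
Proof.
pose nuPN := projT2 (cid (projT2 (cid (Hahn_decomposition nu)))).
rewrite /charge_integral -/nuPN.
rewrite !integral_finite_space -EFinB -sumrB; congr EFin.
apply: eq_bigr => x _.
by rewrite (jordan_posBneg nuPN)// fineB ?mulrBr// fin_num_measure//.
Qed.

Lemma charge_finite_space (nu : {charge set T -> \bar R}) :
  nu [set: T] = (\sum_(x <- s) fine (nu [set x]))%:E.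
Proof.
(* The total mass is the integral of 1, to which the finite sum formula applies. *)
transitivity (charge_integral nu (fun=> 1%:E)); last first.
  by rewrite charge_integral_finite_space; under eq_bigr do rewrite mul1r.
pose nuPN := projT2 (cid (projT2 (cid (Hahn_decomposition nu)))).
rewrite /charge_integral -/nuPN.
by rewrite !integral_cst// !mul1e (jordan_posBneg nuPN).
Qed.

End finite_measurable_space.

(** * The bound for finite subsets *)

Theorem theorem4p7 (R : realType) (n k : nat) (X : set (l1space R n))
    (X0 : X !=set0) (cardX : X #= `I_k) :
  metric_M (subspace_of X0) <= (k%:R / 4)%:E * diameter (subspace_of X0).
Proof.
have [s [us sk sfull]] := enum_card_eq cardX.
pose T : pointedMetricType R := subspace_of X0.
have k0 : (0 < k)%N.
  by rewrite -sk; case: (s) (sfull (point : T)).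
apply: ge_ereal_sup => _ [mu /= muT <-].
have ms (x : borel T) : measurable [set x] by exact: borel_measurable_set1.
pose w (x : T) : R := fine (mu [set x]).
have sumw : (\sum_(x <- s) w x = 1)%R.
  by apply/eqP; rewrite -eqe -muT (@charge_finite_space _ (borel T) _ s).
have -> : energy mu = (\sum_(y <- s) \sum_(x <- s)
    w y * w x * l1dist (set_val y) (set_val x))%:E.
  rewrite /energy.
  under eq_fun do rewrite (@charge_integral_finite_space _ (borel T) _ s)//.
  rewrite (@charge_integral_finite_space _ (borel T) _ s)//; congr EFin.
  apply: eq_bigr => y _; rewrite mulr_suml; apply: eq_bigr => x _.
  by rewrite l1dist_sym -mulrA mulrC mulrAC mulrC mulrA.
have : forall x y : T, (l1dist (set_val x) (set_val y))%:E <= diameter T.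
  by move=> x y; apply: ereal_sup_ubound; exists (x, y).
(* The value [+oo] makes the bound trivial as [k > 0]; [-oo] is excluded by the distance of a point
   to itself. *)
case: (diameter T) => [D lD| _ |/(_ point point)//]; last first.
  by rewrite gt0_muley ?leey// lte_fin divr_gt0// ltr0n.
rewrite -EFinM lee_fin.
have lD' (x y : T) : (l1dist (set_val x) (set_val y) <= D)%R.
  by rewrite -lee_fin.
have := l1_energy_le s (fun x : T => set_val x) w.
rewrite sumw expr1n mul1r => /le_trans.
have := sum_pairs_le s (fun x y : T => l1dist_sym (set_val x) (set_val y))
  (fun x : T => l1distxx (set_val x)) lD'.
move=> /[swap]/[apply]; rewrite sk.
(* For [k = 1] the factor [k - 1] vanishes and cannot be cancelled, but the energy is then 0. *)
have [k1|k1] := ltnP 1 k; last first.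
  have D0 : (0 <= D)%R by have := lD' point point; rewrite l1distxx.
  move=> _; case: (s) sk k1 => [|x [|y t]] /=; try by move=> <-.
    by move=> <- _; rewrite !big_nil mul0r mul0r.
  by move=> <- _; rewrite !big_seq1 l1distxx mulr0; lra.
rewrite (mulrC k%:R) -!mulrA [X in (X <= _)%R]mulrCA ler_pM2l; last first.
  by rewrite ltr0n -subn1 subn_gt0.
by lra.
Qed.
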